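(* Let $K$ be a field, $n\ge 1$, $M\subseteq\mathbb{Z}^n$ a submodule (of any rank $\le n$), and let $I_M\subseteq K[x_1,\dots,x_n]$ be the associated lattice ideal. Then the number of border bases of $I_M$ is finite.
   Context: $\mathbb{N}$ denotes the non-negative integers. For $a=(a_1,\dots,a_n)\in\mathbb{Z}^n$, $a^+\in\mathbb{N}^n$ has $i$-th component $\max(a_i,0)$ and $a^-\in\mathbb{N}^n$ has $i$-th component $\max(-a_i,0)$, so $a=a^+-a^-$. The lattice ideal $I_M$ is the ideal of $K[x_1,\dots,x_n]$ generated by the binomials $x^{a^+}-x^{a^-}$, $a\in M$. An order ideal of $K[x_1,\dots,x_n]$ is a (finite or infinite) set $\mathcal{O}$ of monomials containing all monomial divisors of each of its elements. Its border $\partial\mathcal{O}$ is the set of monomials not in $\mathcal{O}$ that are the product of an element of $\mathcal{O}$ and a variable. A border basis of an ideal $I$ consists of an order ideal $\mathcal{O}$ whose residue classes form a $K$-basis of $K[x_1,\dots,x_n]/I$, together with the set of polynomials $\{b-\sum_{t\in\mathcal{O}}a_{b,t}t \mid b\in\partial\mathcal{O}\}\subseteq I$ (finite sums, $a_{b,t}\in K$). Neither $\mathcal{O}$ nor the border basis is required to be finite, i.e. $I$ need not be zero-dimensional. *)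

(* Defs.v *)
From HB Require Import structures.
From mathcomp Require Import all_boot all_order all_algebra.
From mathcomp Require Import boolp classical_sets functions cardinality.
From mathcomp Require Import mpoly.

Set Implicit Arguments.
Unset Strict Implicit.
Unset Printing Implicit Defensive.

Import Order.TTheory GRing.Theory Num.Theory.

Local Open Scope ring_scope.
Local Open Scope classical_set_scope.

Definition generated_ideal (A : comNzRingType) (S : set A) : set A :=
  [set f | exists2 s : seq (A * A),
     (forall qg, qg \in s -> S qg.2) & f = \sum_(qg <- s) qg.1 * qg.2].

Section LatticeIdeal.
Variable n : nat.

(* The absolute value below only converts a non-negative integer to [nat]. *)
Definition pos_part (a : 'rV[int]_n) : 'X_{1..n} :=
  [multinom `|Num.max (a 0%R i) 0%R|%N | i < n].

Definition neg_part (a : 'rV[int]_n) : 'X_{1..n} :=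
  [multinom `|Num.max (- a 0%R i)%R 0%R|%N | i < n].

Definition lattice_ideal (K : fieldType) (M : set 'rV[int]_n) :
    set {mpoly K[n]} :=
  generated_ideal [set 'X_[pos_part a] - 'X_[neg_part a] | a in M].

End LatticeIdeal.

Arguments lattice_ideal {n} K M.

Section BorderBasis.
Variables (K : fieldType) (n : nat).

(* Monomials are identified with their exponent vectors; [(s <= t)%MM] is the
   componentwise order, i.e. divisibility, and not the monomial order [<=%O]. *)
Definition order_ideal (O : set 'X_{1..n}) : Prop :=
  forall s t, O t -> (s <= t)%MM -> O s.

Definition border (O : set 'X_{1..n}) : set 'X_{1..n} :=
  [set b | ~ O b /\ exists2 t, O t & exists i, b = (t + U_(i))%MM].

(* The polynomials supported in [O] are the finite K-linear combinations of
   (pairwise distinct) elements of [O]. *)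
Definition supported (O : set 'X_{1..n}) (p : {mpoly K[n]}) : Prop :=
  forall t, t \in msupp p -> O t.

(* The family of residue classes of the monomials in [O] is linearly
   independent and generating in the K-vector space K[x_1,...,x_n]/I. *)
Definition quotient_basis (I : set {mpoly K[n]}) (O : set 'X_{1..n}) : Prop :=
  (forall p, supported O p -> I p -> p = 0) /\
  (forall f, exists2 p, supported O p & I (f - p)).

(* A border basis is a pair: an order ideal [BB.1] and a set of polynomials
   [BB.2]; the polynomial [r b] is the sum of the a_{b,t} t over t in [BB.1]. *)
Definition border_basis (I : set {mpoly K[n]})
    (BB : set 'X_{1..n} * set {mpoly K[n]}) : Prop :=
  [/\ order_ideal BB.1,
      quotient_basis I BB.1
    & exists r : 'X_{1..n} -> {mpoly K[n]},
        (forall b, border BB.1 b -> supported BB.1 (r b) /\ I ('X_[b] - r b)) /\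
        BB.2 = [set 'X_[b] - r b | b in border BB.1]].

End BorderBasis.

(* Main.v *)
Require Import Defs.
From HB Require Import structures.
From mathcomp Require Import all_boot all_order all_algebra.
From mathcomp Require Import boolp classical_sets functions cardinality.
From mathcomp Require Import mpoly.

Set Implicit Arguments.
Unset Strict Implicit.
Unset Printing Implicit Defensive.

Import Order.TTheory GRing.Theory Num.Theory.

Local Open Scope ring_scope.
Local Open Scope classical_set_scope.

(** Finiteness comes from the ascending chain condition on monomial ideals. Let
    [I] be an ideal, or just an additive group of polynomials. The polynomials
    of a border basis are determined by its order ideal [O]: two candidates for
    the normal form of a border monomial differ by an element of [I] supported
    in [O], hence are equal ([border_basis_polynomials]). So it suffices to
    bound the number of order ideals [O] whose monomials form a basis modulo
    [I].

    Fix a finite list [s] of monomials and consider only those [O] that avoid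
    [s], hence also all multiples of its members. If no nonzero element of [I]
    is supported on the monomials outside the monomial ideal generated by [s],
    then these monomials are linearly independent modulo [I]. Any two bases [O]
    avoiding [s] lie in this independent family and therefore both equal it, so
    there is at most one. Otherwise pick a nonzero such element [f]. No basis
    contains the whole support of [f], so each [O] avoids some monomial [m] of
    this finite support. Thus finiteness for [s] follows from finiteness for the
    finitely many lists [m :: s], each generating a strictly larger monomial
    ideal ([finite_quotient_bases_avoiding]). This recursion terminates by
    Dickson's lemma, in the form of the induction principle [dickson_ind]; the
    empty list gives the theorem. *)

(** * Dickson's lemma *)

Lemma nondecreasing_subsequence (a : nat -> nat) :
  exists2 g : nat -> nat, {homo g : i j / (i < j)%N} &
    {homo a \o g : i j / (i <= j)%N}.
Proof.
(* Along a chain of [R] each value, except possibly the first, is minimal among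
   all that follow; this is why the chain is shifted by [succn] below. *)
pose R i j := (i < j)%N /\ forall k, (i < k)%N -> (a j <= a k)%N.
have exR i : {j | R i j}.
  apply: cid.
  have exv : exists v, `[< exists2 j, (i < j)%N & a j = v >].
    by exists (a i.+1); apply/asboolP; exists i.+1.
  have [_ /asboolP[j ij <-] minj] := ex_minnP exv.
  by exists j; split=> // k ik; apply: minj; apply/asboolP; exists k.
have [f [_ fR]] := dependent_choice exR 0%N.
have f_incr k : (f k < f k.+1)%N by have [] := fR k.
exists (f \o succn).
  by move=> i j ij; apply: (homo_ltn ltn_trans f_incr).
apply: (homo_leq leqnn leq_trans) => k /=.
have [_] := fR k; apply.
exact: ltn_trans (f_incr _) (f_incr _).
Qed.

Lemma dickson n (u : nat -> 'X_{1..n}) :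
  exists i j, (i < j)%N /\ (u i <= u j)%MM.
Proof.
(* Make the coordinates monotone one after the other. *)
have subseq_mono k : exists2 g : nat -> nat, {homo g : i j / (i < j)%N} &
    forall l : 'I_n, (l < k)%N ->
      {homo (fun i => u (g i) l) : i j / (i <= j)%N}.
  elim: k => [|k [g g_incr g_mono]]; first by exists id.
  have [kn|nk] := ltnP k n; last first.
    by exists g => // l _; apply: g_mono; apply: leq_trans nk.
  have [h h_incr h_mono] :=
    nondecreasing_subsequence (fun i => u (g i) (Ordinal kn)).
  exists (g \o h) => [i j ij|l]; first exact/g_incr/h_incr.
  rewrite ltnS leq_eqVlt => /orP[/eqP lk|lk] i j ij.
    have -> : l = Ordinal kn by apply: val_inj.
    exact: h_mono.
  apply: (g_mono l lk); exact: (ltW_homo h_incr).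
have [g g_incr g_mono] := subseq_mono n.
exists (g 0%N), (g 1%N); split; first exact: g_incr.
by apply/mnm_lepP => l; apply: g_mono.
Qed.

(** Ascending chains of monomial ideals become stationary: a property of finite
    generating sets may be proved assuming it for every extension by a monomial
    outside the ideal generated so far. *)
Lemma dickson_ind n (P : seq 'X_{1..n} -> Prop) :
  (forall s, (forall m, (forall x, x \in s -> ~~ (x <= m)%MM) -> P (m :: s)) ->
     P s) ->
  forall s, P s.
Proof.
move=> step s0; apply: contrapT => nPs0.
pose T := {s | ~ P s}.
pose R (s t : T) := exists m, (forall x, x \in sval s -> ~~ (x <= m)%MM) /\
                               sval t = m :: sval s.
have exR (s : T) : {t | R s t}.
  case: s => s nPs; apply: cid; apply: contrapT => nR; apply: (nPs).
  apply: step => m sm; apply: contrapT => nPms; apply: nR.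
  by exists (exist _ (m :: s) nPms); exists m.
have [f [_ fR]] := dependent_choice exR (exist _ s0 nPs0).
have [u uP] := choice fR.
have f_sub i j : (i <= j)%N -> {subset sval (f i) <= sval (f j)}.
  apply: (homo_leq (r := fun s t : T => {subset sval s <= sval t})).
  - by move=> t x.
  - by move=> t s r st tr x /st/tr.
- by move=> k x xk; have [_ ->] := uP k; rewrite in_cons xk orbT.
have [i [j [ij]]] := dickson u; apply/negP.
have [+ _] := uP j; apply.
apply: (f_sub _ _ ij); have [_ ->] := uP i.
by rewrite mem_head.
Qed.

(** * Order ideals that are bases of the quotient *)

Section QuotientBases.
Variables (K : fieldType) (n : nat) (I : set {mpoly K[n]}).
Hypothesis subI : forall p q, I p -> I q -> I (p - q).

Lemma supportedB (O : set 'X_{1..n}) (p q : {mpoly K[n]}) :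
  supported O p -> supported O q -> supported O (p - q).
Proof.
by move=> Op Oq t /msuppB_le; rewrite mem_cat => /orP[/Op|/Oq].
Qed.

Lemma supportedX (O : set 'X_{1..n}) (t : 'X_{1..n}) :
  O t -> supported O ('X_[t] : {mpoly K[n]}).
Proof. by move=> Ot x; rewrite msuppX inE => /eqP->. Qed.

Lemma sub_supported (A B : set 'X_{1..n}) (p : {mpoly K[n]}) :
  A `<=` B -> supported A p -> supported B p.
Proof. by move=> AB Ap t /Ap/AB. Qed.

(** A generating family contained in an independent one is all of it. *)
Lemma quotient_basis_sub (A O O' : set 'X_{1..n}) :
  (forall p, supported A p -> I p -> p = 0) ->
  O `<=` A -> O' `<=` A -> quotient_basis I O' -> O `<=` O'.
Proof.
move=> indA OA O'A [_ genO'] u Ou.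
have [p O'p Iup] := genO' 'X_[u].
have up : 'X_[u] = p.
  apply/subr0_eq/indA => //.
  by apply: supportedB; [exact: supportedX (OA _ Ou)|exact: sub_supported O'p].
by apply: O'p; rewrite -up msuppX mem_head.
Qed.

Lemma finite_quotient_bases_avoiding (s : seq 'X_{1..n}) :
  finite_set [set O : set 'X_{1..n} | [/\ order_ideal O, quotient_basis I O &
                                         forall x, x \in s -> ~ O x]].
Proof.
elim/dickson_ind: s => s IHs.
pose A : set 'X_{1..n} := [set m | forall x, x \in s -> ~~ (x <= m)%MM].
have OA (O : set 'X_{1..n}) :
    order_ideal O -> (forall x, x \in s -> ~ O x) -> O `<=` A.
  by move=> oO sO m Om x xs; apply/negP => /(oO _ _ Om); apply: sO.
have [indA|/existsNP[f /not_implyP[Af /not_implyP[If f0]]]] :=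
    pselect (forall p, supported A p -> I p -> p = 0).
  apply: contrapT => infO; have [O [oO bO sO]] := infinite_setN0 infO.
  apply: infO; apply: sub_finite_set (finite_set1 O) => O' [oO' bO' sO'] /=.
  by apply/seteqP; split; apply: (quotient_basis_sub indA) => //; apply: OA.
apply: (@sub_finite_set _ _ (\bigcup_(m in [set` msupp f])
  [set O : set 'X_{1..n} | [/\ order_ideal O, quotient_basis I O &
                              forall x, x \in m :: s -> ~ O x]])); last first.
  by apply: bigcup_finite => [|m /= mf]; [exact: finite_seq|apply/IHs/Af].
move=> O /= [oO bO sO].
(* Otherwise [f] would be a relation between elements of the basis [O]. *)
have [m mf Om] : exists2 m, m \in msupp f & ~ O m.
  apply: contrapT => nm; apply: f0; apply: bO.1 => // t tf.
  by apply: contrapT => Ot; apply: nm; exists t.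
by exists m => //; split=> // x; rewrite in_cons => /orP[/eqP->|/sO].
Qed.

(** The set of all border basis polynomials attached to [O]. Describing it
    without choosing normal forms makes it a function of [O]. *)
Definition border_polynomials (O : set 'X_{1..n}) : set {mpoly K[n]} :=
  [set f | exists b r, [/\ border O b, supported O r, I ('X_[b] - r) &
                          f = 'X_[b] - r]].

Lemma border_basis_polynomials BB :
  border_basis I BB -> BB.2 = border_polynomials BB.1.
Proof.
case: BB => O G [/= _ [indO _] [r [rP ->]]].
apply/seteqP; split=> f /= [b].
  by move=> bb <-; have [Or Ir] := rP b bb; exists b, (r b).
case=> p [bb Op Ip ->]; exists b => //; have [Or Ir] := rP b bb.
suff -> : r b = p by [].
apply/subr0_eq/indO; first exact: supportedB.
have -> : r b - p = ('X_[b] - p) - ('X_[b] - r b).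
  by rewrite opprB [RHS]addrC addrA subrK.
exact: subI.
Qed.

Lemma finite_border_bases : finite_set [set BB | border_basis I BB].
Proof.
have finO := finite_quotient_bases_avoiding [::].
apply: sub_finite_set (finite_image (fun O => (O, border_polynomials O)) finO).
move=> BB bBB; have [oO bO _] := bBB.
by exists BB.1 => //=; rewrite -border_basis_polynomials // -surjective_pairing.
Qed.

End QuotientBases.

Lemma generated_idealB (A : comNzRingType) (S : set A) (f g : A) :
  generated_ideal S f -> generated_ideal S g -> generated_ideal S (f - g).
Proof.
move=> [s sS ->] [t tS ->]; exists (s ++ [seq (- qg.1, qg.2) | qg <- t]).
  move=> qg; rewrite mem_cat => /orP[/sS//|/mapP[qg' /tS ? ->//]].
rewrite big_cat big_map /= -sumrN; congr (_ + _).
by apply: eq_bigr => qg _; rewrite mulNr.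
Qed.

Theorem proposition19 (K : fieldType) (n : nat) (n_gt0 : (0 < n)%N)
    (M : set 'rV[int]_n) (M_submod : submod_closed (mem M)) :
  finite_set
    [set BB : set 'X_{1..n} * set {mpoly K[n]} |
       border_basis (lattice_ideal K M) BB].
Proof. by apply: finite_border_bases => p q; apply: generated_idealB. Qed.
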